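(* Let $k\ge 1$ and $h\ge 1$ be integers and let $T$ be the complete $k$-ary tree of height $h$. Then $md(T)$ is finite if and only if $k=1$ or $k=2$. Moreover, if $T$ is the complete binary tree of height $h$, then $md(T)=2^h-1$.
   Context: The complete $k$-ary tree of height $h$ is the rooted tree in which every vertex at levels $0,\dots,h-1$ has exactly $k$ children and all leaves are at level $h$. For $W\subseteq V(T)$, $r_m(v|W)$ is the multiset $\{d(v,w): w\in W\}$ of graph distances; $W$ is an m-resolving set if $r_m(u|W)\neq r_m(v|W)$ for all distinct $u,v$. If $T$ has an m-resolving set, $md(T)$ is the minimum cardinality of one; otherwise $md(T)=\infty$. *)

(* Defs.v *)
From HB Require Import structures.
From mathcomp Require Import all_boot finmap multiset.

Local Open Scope mset_scope.
Local Open Scope nat_scope.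

Set Implicit Arguments.
Unset Strict Implicit.
Unset Printing Implicit Defensive.

Section MultisetDimension.

Variables (V : finType) (e : rel V).

(* In a graph on #|V| vertices a shortest path has fewer than #|V| edges, so
   the search over 0, ..., #|V|.-1 is exhaustive; [gdist x y] takes the junk
   value #|V| exactly when [y] is not reachable from [x]. *)
Definition gdist (x y : V) : nat :=
  find (fun n => [exists p : n.-tuple V, path e x p && (last x p == y)])
       (iota 0 #|V|).

(* The map [gdist v] need not be injective on [W]: repeated distances are
   counted with their multiplicity. *)
Definition mrepr (W : {set V}) (v : V) : {mset nat} :=
  seq_mset [seq gdist v w | w in W].

Definition m_resolving (W : {set V}) : bool :=
  [forall u, forall v, (u != v) ==> (mrepr W u != mrepr W v)].

(* [None] stands for the value infinity. *)
Definition md : option nat :=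
  if [pick W | m_resolving W] is Some W0
  then Some #|[arg min_(W < W0 | m_resolving W) #|W|]|
  else None.

End MultisetDimension.

(* A vertex is the word of length at most h recording the child chosen at each
   step from the root: its length is its level, [::] is the root, and the
   children of [u] are the words [rcons u c]. *)
Definition kary_vertex (k h : nat) : finType := h.-bseq 'I_k.

Definition kary_child (k h : nat) (u v : kary_vertex k h) : bool :=
  [exists c : 'I_k, (v : seq 'I_k) == rcons u c].

Definition kary_adj (k h : nat) : rel (kary_vertex k h) :=
  fun u v => kary_child u v || kary_child v u.
Arguments kary_adj : clear implicits.

Lemma kary_adj_sym k h : symmetric (kary_adj k h).
Proof. by move=> u v; rewrite /kary_adj orbC. Qed.

Lemma kary_adj_irr k h : irreflexive (kary_adj k h).
Proof.
move=> u; rewrite /kary_adj orbb; apply/existsP => -[c /eqP /(congr1 size)].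
by rewrite size_rcons => /eqP; rewrite -[_ == _]/(size u == (size u).+1) ltn_eqF.
Qed.

Lemma card_children k h (u : kary_vertex k h) :
  #|[set v | kary_child u v]| = if size u < h then k else 0.
Proof.
case: ifPn => [lt_uh | ].
  have sz c : size (rcons u c) <= h by rewrite size_rcons.
  pose f (c : 'I_k) : kary_vertex k h := Bseq (sz c).
  have f_inj : injective f by move=> c d /(congr1 val) /rcons_inj [].
  rewrite -[RHS](card_ord k) -(card_imset _ f_inj).
  apply: eq_card => v; rewrite inE; apply/existsP/imsetP => [[c /eqP vE] | [c _ ->]].
    by exists c => //; apply: val_inj.
  by exists c.
rewrite -leqNgt => le_hu; apply: eq_card0 => v; rewrite inE.
apply/existsP => -[c /eqP vE]; have := size_bseq v.
by rewrite vE size_rcons ltnNge le_hu.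
Qed.

Lemma kary_connected k h (u v : kary_vertex k h) : connect (kary_adj k h) u v.
Proof.
pose r : kary_vertex k h := [bseq].
have root_to (w : kary_vertex k h) : connect (kary_adj k h) r w.
  case: w => s; elim/last_ind: s => [|s c IHs] sz.
    by rewrite (_ : Bseq sz = r) ?connect0 //; apply: val_inj.
  have sz' : size s <= h by rewrite ltnW // -(size_rcons s c).
  apply: connect_trans (IHs sz') (connect1 _).
  by apply/orP; left; apply/existsP; exists c.
apply: connect_trans (root_to v).
by rewrite (sym_connect_sym (@kary_adj_sym k h)) root_to.
Qed.

(* Main.v *)
(* If two siblings are leaves, they are told apart only when exactly one of them
   lies in W, which is impossible for three siblings.  For k = 2, going up from
   the leaves, exactly one of any two siblings lies in W: below any vertex p,
   level j >= 1 then contains 2^(j-1) elements of W, so two sibling subtrees can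
   only differ at their roots.  Hence W contains 2^h - 1 vertices besides
   possibly the root.  Conversely, the set of all left children is resolving:
   for h >= 2 the largest distance, |x| + h, gives the level of x, and on a given
   level the distances at most |x| already determine x; for k = 1 the root alone
   is resolving. *)
Require Import Defs.
From mathcomp Require Import all_boot.
From mathcomp Require Import finmap multiset zify.

Set Implicit Arguments.
Unset Strict Implicit.
Unset Printing Implicit Defensive.

(** * Tree distance computed on words *)

Section WordDistance.

Variable T : eqType.
Implicit Types (x y : seq T) (c : T).

(** The common prefix is stripped: the tree path from [x] to [y] climbs to their lowest common
    ancestor and descends. *)
Fixpoint wdist x y : nat :=
  match x, y with
  | a :: x', b :: y' => if a == b then wdist x' y' else size x + size y
  | _, _ => size x + size y
  end.

Lemma wdist0l y : wdist [::] y = size y.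
Proof. by case: y. Qed.

Lemma wdist0r x : wdist x [::] = size x.
Proof. by case: x => //= a x; rewrite addn0. Qed.

Lemma wdistxx x : wdist x x = 0.
Proof. by elim: x => //= a x ->; rewrite eqxx. Qed.

Lemma wdist_eq0 x y : wdist x y = 0 -> x = y.
Proof.
elim: x y => [|a x IHx] [|b y] //=.
by case: eqP => [-> /IHx ->|].
Qed.

Lemma wdist_le x y : wdist x y <= size x + size y.
Proof.
elim: x y => [|a x IHx] [|b y] //=.
by case: eqP => // _; have := IHx y; lia.
Qed.

Lemma wdist_rcons x c y :
  (wdist (rcons x c) y <= (wdist x y).+1) && (wdist x y <= (wdist (rcons x c) y).+1).
Proof.
elim: x y => [|a x IHx] [|b y] //=.
- by case: eqP => _; rewrite ?wdist0l; lia.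
- by rewrite size_rcons; lia.
- by case: eqP => // _; rewrite size_rcons; lia.
Qed.

(** One step towards [y]: down if [x] is a proper prefix of [y], up to the parent otherwise. The
    bound [size x < size y] keeps the child within the height of the tree. *)
Lemma wdist_step x y n : wdist x y = n.+1 ->
  (exists2 c, wdist (rcons x c) y = n & size x < size y) \/
  (exists x' c, x = rcons x' c /\ wdist x' y = n).
Proof.
elim: x y => [|a x IHx] y.
  rewrite wdist0l; case: y => //= c y [yn].
  by left; exists c; rewrite ?eqxx ?wdist0l.
case: y => [|b y] /=.
  rewrite addn0 => -[xn]; right; exists (belast a x), (last a x).
  by rewrite -lastI wdist0r size_belast.
case: eqP => [<- /IHx [[c xcy ltxy]|[x' [c [-> x'y]]]]|neq_ab xyn].
- by left; exists c; rewrite ?eqxx.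
- by right; exists (a :: x'), c; rewrite /= eqxx.
right; exists (belast a x), (last a x); rewrite -lastI; split=> //.
case: x xyn {IHx} => [|d x] //= xyn; first by lia.
by case: eqP neq_ab => //= _ _; rewrite size_belast; lia.
Qed.

End WordDistance.

(** * Graph distance agrees with word distance *)

Section KaryTree.

Variables k h : nat.
Local Notation V := (kary_vertex k h).
Local Notation e := (kary_adj k h).
Implicit Types (x y : V) (p : seq V).

Lemma wdist_adj x y z : e x z -> wdist x y <= (wdist z y).+1.
Proof.
case/orP=> /existsP[c /eqP->].
  by case/andP: (wdist_rcons x c y).
by case/andP: (wdist_rcons z c y).
Qed.

Lemma wdist_path_le x p : path e x p -> wdist x (last x p) <= size p.
Proof.
elim: p x => [|z p IHp] x /=; first by rewrite wdistxx.
case/andP=> exz /IHp IH.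
by apply: leq_trans (wdist_adj (last z p) exz) _; rewrite ltnS.
Qed.

Lemma wdist_path x y :
  exists2 p, path e x p & last x p = y /\ size p = wdist x y.
Proof.
move dxy: (wdist x y) => n.
elim: n x dxy => [|n IHn] x.
  by move/wdist_eq0/val_inj ->; exists [::].
case/wdist_step => [[c xcy ltxy]|[x' [c [xE x'y]]]].
  have sz : size (rcons x c) <= h.
    by rewrite size_rcons; apply: leq_trans ltxy (size_bseq _).
  have [p pp [lp sp]] := IHn (Bseq sz) xcy.
  exists (Bseq sz :: p) => /=; last by rewrite lp sp.
  by rewrite pp andbT; apply/orP; left; apply/existsP; exists c.
have sz : size x' <= h by rewrite ltnW // -(size_rcons x' c) -xE size_bseq.
have [p pp [lp sp]] := IHn (Bseq sz) x'y.
exists (Bseq sz :: p) => /=; last by rewrite lp sp.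
by rewrite pp andbT; apply/orP; right; apply/existsP; exists c; rewrite xE.
Qed.

Lemma gdist_wdist x y : gdist e x y = wdist x y.
Proof.
have [p0 pp0 [lp0 sp0]] := wdist_path x y.
(* A repetition-free path has at most [#|V|] vertices, so the search in [gdist] stops before its
   default value. *)
have lt_card : wdist x y < #|V|.
  case/shortenP: pp0 lp0 => p pp up _ <-.
  apply: leq_ltn_trans (wdist_path_le pp) _.
  by have /card_uniqP/= <- := up; apply: max_card.
rewrite /gdist; set a := (fun n => _).
have a_wd : a (wdist x y).
  by rewrite -sp0; apply/existsP; exists (in_tuple p0); rewrite pp0 lp0 eqxx.
have a_min n : a n -> wdist x y <= n.
  case/existsP=> p /andP[pp /eqP <-].
  by have := wdist_path_le pp; rewrite size_tuple.
have ha : has a (iota 0 #|V|).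
  by apply/hasP; exists (wdist x y); rewrite ?mem_iota.
have lt_find := ha; rewrite has_find size_iota in lt_find.
apply/eqP; rewrite eqn_leq a_min ?andbT.
  by rewrite leqNgt; apply/negP => /(before_find 0); rewrite nth_iota // a_wd.
by have := nth_find 0 ha; rewrite nth_iota.
Qed.

Lemma mreprP (W : {set V}) x y :
  reflect (forall n, \sum_(w in W) (wdist x w == n) = \sum_(w in W) (wdist y w == n))
          (mrepr e W x == mrepr e W y).
Proof.
have countE z n : mrepr e W z n = \sum_(w in W) (wdist z w == n).
  rewrite /mrepr mset_seqE /image_mem count_map -sum1_count.
  rewrite -big_enum big_mkcond /=; apply: eq_bigr => w _.
  by rewrite gdist_wdist; case: eqP.
apply: (iffP eqP) => [eq_xy n|eq_xy]; first by rewrite -!countE eq_xy.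
by apply/msetP => n; rewrite !countE.
Qed.

End KaryTree.

(** * Counting selected words by level and by distance *)

Lemma big_bseqS k h (F : seq 'I_k -> nat) :
  \sum_(w : h.+1.-bseq 'I_k) F w =
  F [::] + \sum_(c < k) \sum_(w : h.-bseq 'I_k) F (c :: w).
Proof.
pose g (u : unit + 'I_k * h.-bseq 'I_k) : h.+1.-bseq 'I_k :=
  if u is inr (c, w) then [bseq of c :: w] else [bseq].
(* The default of [insubd] is never reached: the tail of a word of length at most [h.+1] has length
   at most [h]. *)
pose g' (w : h.+1.-bseq 'I_k) : unit + 'I_k * h.-bseq 'I_k :=
  if val w is c :: s then inr (c, insubd [bseq] s) else inl tt.
have gK : cancel g g' by case=> [[]|[c w]] //; rewrite /g' /= valKd.
have g'K : cancel g' g.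
  case=> [[|c s] sz]; apply: val_inj => //=.
  by rewrite insubdK.
rewrite (reindex g) ?big_sumType /=; last by apply: onW_bij; exists g'.
rewrite (big_pred1 tt) => [|[] //]; rewrite pair_bigA.
by congr addn; apply: eq_bigr => -[].
Qed.

Lemma big_bseq0 k (F : seq 'I_k -> nat) : \sum_(w : 0.-bseq 'I_k) F w = F [::].
Proof.
rewrite (big_pred1 [bseq]) // => -[s sz].
by apply/esym/eqP/val_inj/nilP; rewrite /nilp -leqn0.
Qed.

Section LevelCount.

Variable k : nat.
Implicit Types (P : pred (seq 'I_k)) (h n : nat) (c : 'I_k) (x y : seq 'I_k).

Definition dist_count P h x n := \sum_(w : h.-bseq 'I_k) (P w && (wdist x w == n)).

Definition level_count P h n := \sum_(w : h.-bseq 'I_k) (P w && (size w == n)).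

Lemma dist_count0 P h n : dist_count P h [::] n = level_count P h n.
Proof. by apply: eq_bigr => w _; rewrite wdist0l. Qed.

Definition child P c : pred (seq 'I_k) := fun w => P (c :: w).

Lemma level_countS P h n :
  level_count P h.+1 n = (P [::] && (0 == n)) +
    if n is n'.+1 then \sum_(c < k) level_count (child P c) h n' else 0.
Proof.
rewrite /level_count (big_bseqS _ (fun w => (P w && (size w == n)) : nat)) /=; congr addn.
case: n => [|n] //; rewrite big1 // => c _.
by rewrite big1 // => w _; rewrite andbF.
Qed.

Lemma level_count_top P h : level_count P h 0 = P [::].
Proof.
case: h => [|h]; last by rewrite level_countS addn0 andbT.
by rewrite /level_count (big_bseq0 (fun w => (P w && (size w == 0)) : nat)) andbT.
Qed.

Lemma level_count_gt P h n : h < n -> level_count P h n = 0.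
Proof.
move=> lthn; rewrite /level_count big1 // => w _.
by rewrite ltn_eqF ?andbF // (leq_ltn_trans (size_bseq w)).
Qed.

(** Without the guard, truncated subtraction would count level 0 for every [n] below [m]. *)
Definition shifted_level_count P h m n :=
  if m <= n then level_count P h (n - m) else 0.

Lemma level_count_shift P h m n :
  \sum_(w : h.-bseq 'I_k) (P w && (m + size w == n)) = shifted_level_count P h m n.
Proof.
rewrite /shifted_level_count; case: leqP => lemn.
  by apply: eq_bigr => w _; rewrite -[in LHS](subnKC lemn) eqn_add2l.
rewrite big1 // => w _; case: eqP => [wn|_]; last by rewrite andbF.
by rewrite -wn ltnNge leq_addr in lemn.
Qed.

(** The three terms are the root, the subtree containing [a :: x], and the other subtrees; the
    latter are entered by climbing [(size x).+1] edges to the root and descending one. *)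
Lemma dist_count_cons P h a x n :
  dist_count P h.+1 (a :: x) n =
  (P [::] && ((size x).+1 == n)) + dist_count (child P a) h x n +
  \sum_(c < k | c != a) shifted_level_count (child P c) h (size x).+2 n.
Proof.
rewrite /dist_count (big_bseqS _ (fun w => (P w && (wdist _ w == n)) : nat)).
rewrite wdist0r -addnA; congr addn.
rewrite (bigD1 a) //=; congr addn; first by rewrite eqxx.
apply: eq_bigr => c ca; rewrite -level_count_shift; apply: eq_bigr => w _.
by rewrite /= [a == c]eq_sym (negPf ca) addnS.
Qed.

Lemma eq_shifted_level_count P Q h m n :
  level_count P h =1 level_count Q h ->
  shifted_level_count P h m n = shifted_level_count Q h m n.
Proof. by rewrite /shifted_level_count => ->. Qed.

(** Both siblings are equally far from every vertex outside their two subtrees. Each sees its own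
    subtree by levels and the other's by levels shifted by 2, so equal level profiles make the swap
    invisible. *)
Lemma sibling_dist_count P p a b h :
  size p < h ->
  level_count (fun w => P (p ++ a :: w)) (h - (size p).+1) =1
  level_count (fun w => P (p ++ b :: w)) (h - (size p).+1) ->
  dist_count P h (rcons p a) =1 dist_count P h (rcons p b).
Proof.
elim: p P h => [|c p IHp] P [|h] //= ltph eq_ab n.
  rewrite !dist_count_cons !dist_count0; rewrite subSS subn0 in eq_ab.
  have [->//|neq_ab] := eqVneq a b.
  rewrite -!addnA; congr addn; rewrite eq_ab; congr addn.
  (* Isolate the subtree of the opposite sibling on each side; the remaining subtrees are the
     same. *)
  rewrite (bigD1 b) 1?eq_sym //= [RHS](bigD1 a) //=.
  congr addn; first by apply: eq_shifted_level_count => m; rewrite eq_ab.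
  by apply: eq_bigl => i; rewrite andbC.
by rewrite !dist_count_cons !size_rcons IHp.
Qed.

End LevelCount.

(** * Binary trees: sibling pairs and left children *)

Section Binary.

Implicit Types (P : pred (seq 'I_2)) (h n : nat).

Definition sibling_split P h :=
  forall p, size p < h -> P (rcons p ord0) != P (rcons p ord_max).

Lemma sibling_split_child P h c : sibling_split P h.+1 -> sibling_split (child P c) h.
Proof. by move=> splitP p ltph; apply: (splitP (c :: p)). Qed.

(** Level [n.+1] consists of [2 ^ n] sibling pairs, each contributing one selected vertex. *)
Lemma level_count_split P h n : sibling_split P h -> n < h ->
  level_count P h n.+1 = 2 ^ n.
Proof.
elim: h P n => // h IHh P n splitP ltnh.
rewrite level_countS andbF add0n !big_ord_recl big_ord0 addn0.
rewrite (_ : lift _ _ = ord_max); last exact: val_inj.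
have split c := sibling_split_child c splitP.
case: n ltnh => [|n] ltnh; last first.
  by rewrite !IHh ?addnn -?mul2n ?expnS.
rewrite !level_count_top; have /= := splitP [::] isT.
by rewrite /child; case: (P _); case: (P _).
Qed.

Lemma card_split P h : sibling_split P h ->
  \sum_(w : h.-bseq 'I_2) P w = P [::] + (2 ^ h - 1).
Proof.
elim: h P => [|h IHh] P splitP; first by rewrite (big_bseq0 (fun w => P w : nat)) addn0.
rewrite (big_bseqS _ (fun w => P w : nat)) !big_ord_recl big_ord0 addn0 /=; congr addn.
rewrite (_ : lift _ _ = ord_max); last exact: val_inj.
have IH c := IHh _ (sibling_split_child c splitP).
rewrite /child in IH; rewrite !IH expnS.
have /= := splitP [::] isT; have := expn_gt0 2 h.
by case: (P _); case: (P _) => //= *; lia.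
Qed.

(** Induction from the leaves up, on [h - size p]. If the children of [p] agreed in [P], the
    splitting already known below them would force equal counts on all levels of their subtrees, and
    [sibling_dist_count] would leave them unresolved. *)
Lemma split_of_resolving P h :
  (forall p, size p < h ->
     ~ dist_count P h (rcons p ord0) =1 dist_count P h (rcons p ord_max)) ->
  sibling_split P h.
Proof.
move=> resP p; have [m] := ubnP (h - size p).
elim: m p => // m IHm p le_m ltph; apply/negP => /eqP Peq.
apply: (resP p ltph); apply: sibling_dist_count => // n.
have split c : sibling_split (fun w => P (p ++ c :: w)) (h - (size p).+1).
  move=> q ltq; rewrite -!rcons_cons -!rcons_cat.
  by apply: IHm; rewrite size_cat /=; lia.
case: n => [|n]; first by rewrite !level_count_top !cats1 Peq.
have [ltn|len] := ltnP n (h - (size p).+1); first by rewrite !level_count_split.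
by rewrite !level_count_gt.
Qed.

(* [b] decides whether the root is selected; it makes the family closed under
   [child], since [child (left_words b) c] is convertible to [left_words c]. *)
Definition left_words (b : 'I_2) : pred (seq 'I_2) := fun w => last b w == ord0.

Lemma left_words_split b h : sibling_split (left_words b) h.
Proof. by move=> p _; rewrite /left_words !last_rcons. Qed.

Lemma left_words_root_inj b c : left_words b [::] = left_words c [::] :> nat -> b = c.
Proof. by case: b c => [[|[|//]] ?] [[|[|//]] ?] //= _; apply: val_inj. Qed.

(* The vertices within distance [size x] of [x] other than the root all lie in
   the subtree of the first letter, which makes the induction work. *)
Lemma dist_count_left_inj h b c (x y : seq 'I_2) :
  size x <= h -> size x = size y ->
  (forall n, n <= size x ->
    dist_count (left_words b) h x n = dist_count (left_words c) h y n) ->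
  b = c /\ x = y.
Proof.
elim: x h b c y => [|a x IHx] h b c [|a' y] //.
  move=> _ _ /(_ 0 isT); rewrite !dist_count0 !level_count_top.
  by move/left_words_root_inj.
case: h => // h lexh [sxy] eq_count.
have far P (d : 'I_2) n : n < (size x).+2 ->
    \sum_(i < 2 | i != d) shifted_level_count (child P i) h (size x).+2 n = 0.
  by move=> ltn; rewrite big1 // => i _; rewrite /shifted_level_count leqNgt ltn.
(* In the subtree the first letter plays the role of the root flag, so the induction hypothesis
   recovers it along with the tail. *)
have [eq_a eq_x] : a = a' /\ x = y.
  apply: (IHx h) => // n len; have := eq_count n (leqW len).
  rewrite !dist_count_cons -sxy !far ?ltnS ?leqW // !addn0.
  by rewrite (gtn_eqF (_ : n < (size x).+1)) ?andbF.
(* The root is at distance [(size x).+1]; with the subtree terms now equal, this count reveals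
   whether it is selected. *)
have := eq_count (size x).+1 (leqnn _); rewrite -eq_a -eq_x.
rewrite !dist_count_cons !far // !addn0 eqxx !andbT.
by move/addIn/left_words_root_inj ->.
Qed.

(** Height 1 needs its own test for the level: the only selected vertex is the left leaf, which has
    no selected vertex at distance [size x + h] from itself. *)
Lemma dist_count_height1 (x : seq 'I_2) : size x <= 1 ->
  dist_count (left_words ord_max) 1 x 1 = (size x == 0).
Proof.
case: x => [|a [|//]] _.
  by rewrite dist_count0 level_countS !big_ord_recl big_ord0 !level_count_top.
by rewrite dist_count_cons dist_count0 level_count_gt // big1.
Qed.

Lemma farthest_left_word h (x : seq 'I_2) : 1 < h ->
  exists w : h.-bseq 'I_2, left_words ord_max w /\ wdist x w = size x + h.
Proof.
case: h => [|[|h]] // _.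
(* Starting with a letter other than the first one of [x] forces the path through the root; as [h]
   is at least 2, the last letter can still be chosen as [ord0]. *)
pose d : 'I_2 := if x is a :: _ then (if a == ord0 then ord_max else ord0) else ord0.
have last_d : last d (nseq h.+1 ord0) = ord0 by rewrite /=; elim: (h).
have dist_d : wdist x (d :: nseq h.+1 ord0) = size x + h.+2.
  rewrite /d; case: x {last_d} @d => [|a x] /=; rewrite ?size_nseq //.
  by case: (eqVneq a ord0) => [->|/negPf->]; rewrite //= size_nseq.
have sz : size (d :: nseq h.+1 ord0) <= h.+2 by rewrite /= size_nseq.
by exists (Bseq sz); split=> //; apply/eqP; apply: last_d.
Qed.

End Binary.

(** * From vertex sets to predicates on words, and the dimension *)

Section MetricDimension.

Lemma md_SomeP (V : finType) (e : rel V) :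
  (exists n, md e = Some n) <-> (exists W, m_resolving e W).
Proof.
rewrite /md; case: pickP => [W resW|no_res]; first by split=> _; [exists W | eexists].
by split=> [[]//|[W]]; rewrite no_res.
Qed.

Lemma md_min (V : finType) (e : rel V) (W0 : {set V}) :
  m_resolving e W0 -> (forall W, m_resolving e W -> #|W0| <= #|W|) ->
  md e = Some #|W0|.
Proof.
move=> resW0 minW0; rewrite /md; case: pickP => [W1 resW1|/(_ W0)]; last by rewrite resW0.
case: arg_minnP => // W resW minW.
by congr Some; apply/eqP; rewrite eqn_leq minW // minW0.
Qed.

Variables k h : nat.
Local Notation V := (kary_vertex k h).
Local Notation e := (kary_adj k h).

(** Membership is extended to all words, false beyond length [h], so that it can be restricted to
    subtrees by prefixing. *)
Definition word_pred (W : {set V}) : pred (seq 'I_k) :=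
  fun s => s \in [seq val w | w in W].

Lemma word_predE (W : {set V}) (w : V) : word_pred W w = (w \in W).
Proof. by rewrite /word_pred mem_map ?mem_enum //; apply: val_inj. Qed.

Lemma card_word_pred (W : {set V}) : #|W| = \sum_(w : V) word_pred W w.
Proof.
rewrite -sum1_card big_mkcond; apply: eq_bigr => w _.
by rewrite word_predE; case: ifP.
Qed.

Lemma mrepr_dist_countP (W : {set V}) (P : pred (seq 'I_k)) (x y : V) :
  (forall w : V, (w \in W) = P w) ->
  reflect (dist_count P h x =1 dist_count P h y) (mrepr e W x == mrepr e W y).
Proof.
move=> WP; have E z n : \sum_(w in W) (wdist z w == n) = dist_count P h z n.
  by rewrite big_mkcond; apply: eq_bigr => w _; rewrite WP; case: (P w).
by apply: (iffP (mreprP W x y)) => eq_xy n; have := eq_xy n; rewrite !E.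
Qed.

Lemma m_resolving_sibling (W : {set V}) p a b : m_resolving e W -> size p < h -> a != b ->
  ~ dist_count (word_pred W) h (rcons p a) =1 dist_count (word_pred W) h (rcons p b).
Proof.
move=> resW ltph neq_ab.
have sz c : size (rcons p c) <= h by rewrite size_rcons.
have /forallP/(_ (Bseq (sz a)))/forallP/(_ (Bseq (sz b)))/implyP := resW.
have neq_v : Bseq (sz a) != Bseq (sz b).
  by apply: contraNneq neq_ab => /(congr1 val)/= /rcons_inj[->].
move=> /(_ neq_v) /negP; apply: contra_not => eq_ab.
exact/(mrepr_dist_countP _ _ (fun w => esym (word_predE W w))).
Qed.

End MetricDimension.

Lemma not_resolving_kary k h (W : {set kary_vertex k h}) :
  2 < k -> 0 < h -> ~~ m_resolving (kary_adj k h) W.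
Proof.
case: k W => [|[|[|k]]] //; case: h => // h W _ _; apply/negP => resW.
(* The height is now [h.+1], so the children of [p] are leaves. *)
set P := word_pred W; pose p := nseq h (ord0 : 'I_k.+3).
have neqP a b : a != b -> P (rcons p a) != P (rcons p b).
  move=> neq_ab; apply/negP => /eqP Peq.
  have ltph : size p < h.+1 by rewrite size_nseq.
  apply: (m_resolving_sibling resW ltph neq_ab).
  apply: sibling_dist_count => // n; rewrite size_nseq subnn /level_count.
  apply: eq_bigr => w _; suff -> : bseqval w = [::] by rewrite !cats1 -/P Peq.
  by apply/nilP; rewrite /nilp -leqn0 size_bseq.
pose c i : 'I_k.+3 := inord i.
have c_neq i j : i < 3 -> j < 3 -> i != j -> c i != c j.
  by move=> lti ltj; rewrite -val_eqE /= !inordK //; lia.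
(* Three booleans cannot be pairwise distinct. *)
have := neqP _ _ (c_neq 0 1 isT isT isT).
have := neqP _ _ (c_neq 0 2 isT isT isT).
have := neqP _ _ (c_neq 1 2 isT isT isT).
by do 3!case: (P _).
Qed.

Lemma resolving_path h : m_resolving (kary_adj 1 h) [set [bseq]].
Proof.
apply/forallP => x; apply/forallP => y; apply/implyP; apply: contra.
move/mreprP => /(_ (size x)); rewrite !big_set1 !wdist0r eqxx.
case: eqP => // sxy _; apply/eqP/val_inj/(@eq_from_nth _ ord0) => // i _.
by rewrite [LHS]ord1 [RHS]ord1.
Qed.

Definition left_vertices h : {set kary_vertex 2 h} :=
  [set w : kary_vertex 2 h | left_words ord_max w].

Lemma left_vertices_resolving h : 0 < h -> m_resolving (kary_adj 2 h) (left_vertices h).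
Proof.
move=> h_gt0; apply/forallP => x; apply/forallP => y; apply/implyP; apply: contra.
have inW (w : kary_vertex 2 h) : (w \in left_vertices h) = left_words ord_max w by rewrite inE.
move/(mrepr_dist_countP _ _ inW) => eq_xy; apply/eqP/val_inj.
suff sxy : size x = size y.
  by case: (dist_count_left_inj (size_bseq x) sxy (fun n _ => eq_xy n)).
have [h_gt1|h_le1] := ltnP 1 h; last first.
  have h1 : h = 1 by apply/eqP; rewrite eqn_leq h_le1.
  move: (bseqval x) (bseqval y) (size_bseq x) (size_bseq y) (eq_xy 1) => u v.
  rewrite h1 => leu lev; rewrite !dist_count_height1 //.
  by case: (size u) (size v) leu lev => [|[|]] // [|[|]].
(* Some selected vertex is at distance [size u + h] from [u], while none is farther than
   [size v + h] from [v]. *)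
have le_size (u v : kary_vertex 2 h) :
    dist_count (left_words ord_max) h u =1 dist_count (left_words ord_max) h v ->
    size u <= size v.
  move=> eq_uv; have [w [Pw uw]] := farthest_left_word u h_gt1.
  rewrite leqNgt; apply/negP => ltvu.
  have : 0 < dist_count (left_words ord_max) h u (size u + h).
    by rewrite /dist_count (bigD1 w) //= Pw uw eqxx.
  rewrite eq_uv /dist_count big1 // => z _.
  rewrite ltn_eqF ?andbF //; apply: leq_ltn_trans (wdist_le _ _) _.
  by rewrite -addSn leq_add // size_bseq.
by apply/eqP; rewrite eqn_leq !le_size // => n; rewrite eq_xy.
Qed.

Lemma card_left_vertices h : #|left_vertices h| = 2 ^ h - 1.
Proof.
have := card_split (@left_words_split ord_max h).
rewrite /= add0n => <-; rewrite -sum1_card big_mkcond; apply: eq_bigr => w _.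
by rewrite inE; case: (left_words _ _).
Qed.

(** The exact count is [2 ^ h - 1] plus the contribution of the root, which is dropped. *)
Lemma resolving_binary_card h (W : {set kary_vertex 2 h}) :
  m_resolving (kary_adj 2 h) W -> 2 ^ h - 1 <= #|W|.
Proof.
move=> resW; rewrite card_word_pred card_split ?leq_addl //.
by apply: split_of_resolving => p ltph; apply: m_resolving_sibling.
Qed.

Theorem theorem3p7 (k h : nat) (hk : 1 <= k) (hh : 1 <= h) :
  ((exists n : nat, md (kary_adj k h) = Some n) <-> (k = 1 \/ k = 2)) /\
  md (kary_adj 2 h) = Some (2 ^ h - 1).
Proof.
split; last first.
  rewrite -card_left_vertices; apply: md_min; first exact: left_vertices_resolving.
  by move=> W resW; rewrite card_left_vertices resolving_binary_card.
split=> [/md_SomeP[W resW]|k12].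
  case: (ltnP 2 k) => [k_gt2|]; last by lia.
  by case/negP: (not_resolving_kary W k_gt2 hh).
apply/md_SomeP; case: k12 hk => -> _.
  by exists [set [bseq]]; apply: resolving_path.
by exists (left_vertices h); apply: left_vertices_resolving.
Qed.
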